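(* Let $X$ be a two-sided subshift on a finite alphabet endowed with a mixing shift-invariant probability measure of maximal entropy $\mu$, positive on all cylinders in $X$. Let $Y\subset X$ be a subshift such that $0<h(Y)<h(X)$. Then for any $\epsilon>0$ there exists a finite overlapping union $\mathcal{G}$ of shifted cylinders in $X$ such that $\mu(\mathcal{G})>1-\epsilon$ and $Y\subset\mathcal{J}(\mathcal{G})$ (so, in particular, $h(\mathcal{J}(\mathcal{G}))>0$).
   Context: Let $\mathcal{A}$ be a finite alphabet and $\sigma:\mathcal{A}^{\mathbb{Z}}\to\mathcal{A}^{\mathbb{Z}}$ the left shift, $(\sigma x)_i=x_{i+1}$. A (two-sided) subshift is a set $X\subset\mathcal{A}^{\mathbb{Z}}$, closed in the product topology, with $\sigma(X)=X$. $\mathcal{L}_n(X)$ denotes the set of words of length $n$ occurring in elements of $X$, $\mathcal{L}(X)=\bigcup_{n\ge0}\mathcal{L}_n(X)$, and the topological entropy is $h(X)=\lim_{n\to\infty}\frac{\log\#\mathcal{L}_n(X)}{n}$. For $w=w_1\dots w_n\in\mathcal{L}(X)$ the cylinder $[w]$ is the set of all $(x_j)_{j\in\mathbb{Z}}\in X$ with $x_1=w_1,\dots,x_n=w_n$; a shifted cylinder is a set $\sigma^{-r}[w]$ with $r\in\mathbb{Z}$. The measure $\mu$ is mixing if $\mu(\sigma^{-n}[w]\cap[w'])\to\mu([w])\mu([w'])$ as $n\to+\infty$ for every pair of cylinders. A finite collection of shifted cylinders $\{\sigma^{-r_1}[w_1],\dots,\sigma^{-r_n}[w_n]\}$ is overlapping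 if for all $i$ and $j$ there exist indices $i=i_1,i_2,\dots,i_s=j$ such that $\mu(\sigma^{-r_{i_k}}[w_{i_k}]\cap\sigma^{-r_{i_{k+1}}}[w_{i_{k+1}}])>0$ for each $1\le k<s$; the union of such a collection is called a finite overlapping union. For $H\subset X$, the survivor set $\mathcal{J}(H)$ is the set of all $x\in X$ such that $\sigma^n x\notin H$ for all $n\in\mathbb{Z}$. *)

(* Defs.v *)
From HB Require Import structures.
From mathcomp Require Import all_boot all_order all_algebra.
From mathcomp Require Import all_classical all_reals all_analysis.

Set Implicit Arguments.
Unset Strict Implicit.
Unset Printing Implicit Defensive.

Import Order.TTheory GRing.Theory Num.Theory.
Import numFieldNormedType.Exports.

Local Open Scope classical_set_scope.
Local Open Scope ring_scope.

(* Nonempty finite types: mathcomp-analysis puts measurable structures on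
   pointed types only. The chosen point plays no role below, and over an empty
   alphabet there are no bi-infinite sequences, hence no probability. *)
#[short(type="pointedFinType")]
HB.structure Definition PointedFinite := {T of Finite T & Pointed T}.

(* A^Z with the product of the discrete topologies and its Borel sigma-algebra *)
Definition fullshift (A : Type) : Type :=
  prod_topology (fun _ : int => discrete_topology A).

HB.instance Definition _ (A : pointedType) := Pointed.on (fullshift A).
HB.instance Definition _ (A : pointedType) := Nbhs.on (fullshift A).
HB.instance Definition _ (A : pointedType) := Topological.on (fullshift A).
HB.instance Definition _ (A : pointedType) :=
  Measurable.copy (fullshift A)
    (g_sigma_algebraType (@open (fullshift A))).

Section subshifts.
Variable A : pointedFinType.
Implicit Types (X H : set (fullshift A)) (x : fullshift A) (w : seq A).

(* sigma^n for n in Z; the left shift itself is [shift_by 1] *)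
Definition shift_by (n : int) x : fullshift A := fun i => x (i + n).

Definition subshift X := closed X /\ shift_by 1 @` X = X.

(* the word x_k x_(k+1) ... x_(k+n-1) *)
Definition word x (k : int) (n : nat) : seq A :=
  mkseq (fun i => x (k + i%:Z)) n.

Definition language X : set (seq A) :=
  [set w | exists2 x, X x & exists k : int, word x k (size w) = w].

Definition language_n (n : nat) X : {set n.-tuple A} :=
  [set w : n.-tuple A | `[< language X w >]]%SET.

Definition cylinder X w : set (fullshift A) :=
  X `&` [set x | word x 1 (size w) = w].

(* sigma^(-r)[w] *)
Definition shifted_cylinder X (r : int) w : set (fullshift A) :=
  shift_by r @^-1` cylinder X w.

Definition survivor X H : set (fullshift A) :=
  [set x | X x /\ forall n : int, ~ H (shift_by n x)].

Definition top_entropy (R : realType) X : R :=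
  lim ((fun n : nat => ln (#|language_n n X|%:R : R) / n%:R) @ \oo).

End subshifts.

Section measures.
Variables (R : realType) (A : pointedFinType).
Implicit Types (mu nu : probability (fullshift A) R) (X : set (fullshift A)).

(* An invariant Borel probability on X is represented by its extension to A^Z,
   i.e. an invariant Borel probability on A^Z giving mass 1 to X. *)
Definition invariant_probability X mu :=
  mu X = 1%E /\
  forall B : set (fullshift A), measurable B -> mu (shift_by 1 @^-1` B) = mu B.

Definition finite_partition (k : nat) (P : 'I_k -> set (fullshift A)) :=
  [/\ forall i, measurable (P i), trivIset setT P & \bigcup_i P i = setT].

(* the atom of the join of the sigma^(-j) P, 0 <= j < n, with labels c *)
Definition join_atom (k : nat) (P : 'I_k -> set (fullshift A)) (n : nat)
    (c : {ffun 'I_n -> 'I_k}) : set (fullshift A) :=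
  \bigcap_(j : 'I_n) (shift_by (nat_of_ord j)%:Z @^-1` P (c j)).

(* Shannon entropy of that join; terms with p = 0 vanish as in the convention
   0 log 0 = 0. *)
Definition join_entropy mu (k : nat) (P : 'I_k -> set (fullshift A))
    (n : nat) : R :=
  \sum_(c : {ffun 'I_n -> 'I_k})
    (let p := fine (mu (join_atom P c)) in - (p * ln p)).

(* Kolmogorov-Sinai entropy of the shift *)
Definition measure_entropy mu : \bar R :=
  ereal_sup [set h : \bar R | exists (k : nat) (P : 'I_k -> set (fullshift A)),
    finite_partition P /\
    h = (lim ((fun n : nat => join_entropy mu P n / n%:R) @ \oo))%:E].

Definition maximal_entropy_measure X mu :=
  invariant_probability X mu /\
  forall nu, invariant_probability X nu ->
    (measure_entropy nu <= measure_entropy mu)%E.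

Definition mixing X mu :=
  forall w w' : seq A, language X w -> language X w' ->
    (fun n : nat => mu (shifted_cylinder X n%:Z w `&` cylinder X w')) @ \oo
      --> (mu (cylinder X w) * mu (cylinder X w'))%E.

Definition positive_on_cylinders X mu :=
  forall w : seq A, language X w -> (0 < mu (cylinder X w))%E.

(* [connect] is the existence of a chain i = i_1, ..., i_s = j of indices whose
   consecutive cylinders meet in positive measure. *)
Definition overlapping X mu (n : nat) (r : 'I_n -> int) (w : 'I_n -> seq A) :=
  forall i j : 'I_n,
    connect (fun a b : 'I_n =>
      (0 < mu (shifted_cylinder X (r a) (w a) `&`
               shifted_cylinder X (r b) (w b)))%E) i j.

Definition finite_overlapping_union X mu (G : set (fullshift A)) :=
  exists (n : nat) (r : 'I_n.+1 -> int) (w : 'I_n.+1 -> seq A),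
    [/\ forall i, language X (w i), overlapping X mu r w &
        G = \bigcup_i shifted_cylinder X (r i) (w i)].

End measures.

(* Main.v *)
(* Since h(Y) < h(X), some word w of X does not occur in Y, so no shifted cylinder
   of w meets Y. Take G to be the union of sigma^(-i)[w] for 0 <= i <= N. By mixing
   its measure tends to 1. By mixing again, two of these cylinders meet in
   positive measure once their shifts differ by at least some M, so for N >= 4M any
   two are linked through a third. Finally h(J(G)) >= h(Y), where the limit defining h(J(G)) exists by Fekete's lemma. *)
Require Import Defs.
From mathcomp Require Import zify lra.
From mathcomp Require Import all_boot all_order all_algebra.
From mathcomp Require Import all_classical all_reals all_analysis.

Set Implicit Arguments.
Unset Strict Implicit.
Unset Printing Implicit Defensive.

Import Order.TTheory GRing.Theory Num.Theory.
Import numFieldNormedType.Exports.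

Local Open Scope classical_set_scope.
Local Open Scope ring_scope.

(** * Convergence of subadditive sequences *)

(** Fekete's lemma: dividing n by a nearly optimal m with remainder shows that the quotients tend to
    their infimum over n > 0, which is finite because [a] is nonnegative. *)
Lemma subadditive_cvg (R : realType) (a : nat -> R) :
  (forall n, 0 <= a n) -> (forall m n, a (m + n)%N <= a m + a n) ->
  cvg ((fun n => a n / n%:R) @ \oo).
Proof.
move=> a0 aD.
have aM q m r : a (q * m + r)%N <= q%:R * a m + a r.
  elim: q => [|q IH]; first by rewrite mul0n add0n mul0r add0r.
  rewrite mulSn -addnA (le_trans (aD _ _))// -natr1 mulrDl mul1r.
  by rewrite addrAC addrC lerD2l.
pose E := [set a n / n%:R | n in [set n | (0 < n)%N]].
have E0 : lbound E 0 by move=> _ [n _ <-]; rewrite divr_ge0.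
have hE : has_inf E by split; [exists (a 1%N / 1), 1%N | exists 0].
apply/cvg_ex; exists (inf E); apply/cvgrPdist_lt => e e0.
have e20 : 0 < e / 2 by rewrite divr_gt0.
have [_ [m m0 <-] mE] := inf_adherent e20 hE.
(* [C] bounds [a] at every remainder r < m, by [aM] with step 1 and remainder 0; the term [a 0]
   stays, since subadditivity does not make it vanish. *)
pose C := m%:R * a 1%N + a 0%N.
near=> n.
have n0 : (0 < n)%N by near: n; exact: nbhs_infty_gt.
have n0R : 0 < n%:R :> R by rewrite ltr0n.
have m0R : 0 < m%:R :> R by rewrite ltr0n.
have infn : inf E <= a n / n%:R by apply: ge_inf; [exists 0 | exists n].
rewrite ler0_norm ?subr_le0// opprB ltrBlDl.
have ar : a (n %% m)%N <= C.
  rewrite -[(n %% m)%N]muln1 -[(_ * 1)%N]addn0 (le_trans (aM _ _ _))// lerD2r.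
  by rewrite ler_wpM2r// ler_nat ltnW// ltn_mod.
have an : a n <= n%:R / m%:R * a m + C.
  rewrite {1}(divn_eq n m) (le_trans (aM _ _ _))// lerD// ler_wpM2r//.
  by rewrite ler_pdivlMr// -natrM ler_nat leq_divM.
have Cn : C < n%:R * (e / 2).
  by rewrite -ltr_pdivrMr//; near: n; exact: nbhs_infty_gtr.
rewrite ltr_pdivrMr// (le_lt_trans an)//.
have -> : n%:R / m%:R * a m = n%:R * (a m / m%:R) by rewrite mulrAC mulrA.
have : n%:R * (a m / m%:R) < n%:R * (inf E + e / 2) by rewrite ltr_pM2l.
move: Cn; lra.
Unshelve. all: by end_near. Qed.

Lemma ln_natr_ge0 (R : realType) (n : nat) : 0 <= ln (n%:R : R).
Proof. by case: n => [|n]; [rewrite ln0|apply: ln_ge0; rewrite ler1n]. Qed.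

(** * Words, entropy and cylinders of subshifts *)

Section subshift_theory.
Variable A : pointedFinType.
Implicit Types (X Y Z : set (fullshift A)) (x y : fullshift A) (w : seq A).

Lemma word_eqP x k w : word x k (size w) = w <->
  forall i, (i < size w)%N -> x (k + i%:Z) = nth point w i.
Proof.
split=> [<- i|xw]; first by rewrite size_mkseq => iw; rewrite nth_mkseq.
apply: (@eq_from_nth _ point); rewrite size_mkseq// => i iw.
by rewrite nth_mkseq// xw.
Qed.

Lemma word_tupleP x k n (t : n.-tuple A) : word x k (size t) = t <->
  forall i : 'I_n, x (k + i%:Z) = tnth t i.
Proof.
rewrite word_eqP size_tuple; split=> [xt i|xt i iw].
  by rewrite xt// (tnth_nth point).
by have := xt (Ordinal iw); rewrite (tnth_nth point).
Qed.

(** Cutting a word after m letters is injective and leaves two words of the language. *)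
Lemma card_language_nD Z m n :
  (#|language_n (m + n) Z| <= #|language_n m Z| * #|language_n n Z|)%N.
Proof.
pose f (t : (m + n).-tuple A) :=
  ([tuple tnth t (lshift n i) | i < m], [tuple tnth t (rshift m i) | i < n]).
have f_inj : injective f.
  move=> s t /pair_equal_spec[st1 st2]; apply: eq_from_tnth => i.
  rewrite -(fintype.splitK i); case: (fintype.split i) => j /=.
    by have := congr1 (fun u => tnth u j) st1; rewrite !tnth_mktuple.
  by have := congr1 (fun u => tnth u j) st2; rewrite !tnth_mktuple.
rewrite -cardsX -(card_imset _ f_inj); apply/subset_leq_card.
apply/fintype.subsetP => _ /imsetP[t tZ ->].
move: tZ; rewrite !inE => -[x Zx [k /word_tupleP xt]]; apply/andP; split; apply/asboolP.
  by exists x => //; exists k; apply/word_tupleP => i; rewrite tnth_mktuple -xt.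
exists x => //; exists (k + m%:Z); apply/word_tupleP => i.
by rewrite tnth_mktuple -xt /= PoszD addrA.
Qed.

(** Fekete's lemma for the logarithms of the word counts. [Z] is arbitrary, so that survivor sets
    are covered. *)
Lemma top_entropy_cvg (R : realType) Z :
  cvg ((fun n : nat => ln (#|language_n n Z|%:R : R) / n%:R) @ \oo).
Proof.
apply: (@subadditive_cvg R (fun n => ln #|language_n n Z|%:R)) => [n|m n].
  exact: ln_natr_ge0.
have := card_language_nD Z m n.
(* If there is no word of length m + n, the default [ln 0 = 0] lies below the nonnegative right-hand
   side; otherwise both factors are positive and [ln] turns the product into a sum. *)
case: #|language_n (m + n) Z| => [_|k le]; first by rewrite ln0 ?addr_ge0 ?ln_natr_ge0.
have : (0 < #|language_n m Z| * #|language_n n Z|)%N by apply: leq_trans le.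
rewrite muln_gt0 => /andP[mZ nZ].
rewrite -lnM ?posrE ?ltr0n// ler_ln ?posrE ?mulr_gt0 ?ltr0n//.
by rewrite -natrM ler_nat.
Qed.

(** Serves twice: its contrapositive yields a word of X absent from Y, and it bounds the entropy of
    the survivor set from below. *)
Lemma top_entropy_le (R : realType) Y Z :
  language Y `<=` language Z -> top_entropy R Y <= top_entropy R Z.
Proof.
move=> YZ; apply: ler_lim; [exact: top_entropy_cvg..|apply: nearW => n].
rewrite ler_wpM2r ?invr_ge0//.
have : (#|language_n n Y| <= #|language_n n Z|)%N.
  by apply/subset_leq_card/fintype.subsetP => t; rewrite !inE; exact: YZ.
case: #|language_n n Y| => [_|k le].
  by rewrite ln0// ln_natr_ge0.
by rewrite ler_ln ?posrE ?ltr0n ?ler_nat//; apply: leq_trans le.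
Qed.

Lemma languageS Y Z : Y `<=` Z -> language Y `<=` language Z.
Proof. by move=> YZ w [x Yx xw]; exists x => //; exact: YZ. Qed.

Lemma shift_byD (m n : int) x : shift_by m (shift_by n x) = shift_by (m + n) x.
Proof. by apply/funext => i; rewrite /shift_by addrA. Qed.

Lemma word_shift_by (r k : int) n x : word (shift_by r x) k n = word x (k + r) n.
Proof. by apply: eq_mkseq => i; rewrite /shift_by addrAC. Qed.

(** The shift is injective, so sigma(X) = X gives both directions for one step; induction does the
    rest. *)
Lemma subshift_shift_by X (n : nat) x :
  subshift X -> X (shift_by n%:Z x) <-> X x.
Proof.
move=> [_ sX]; have sX1 y : X (shift_by 1 y) <-> X y.
  split; last by move=> Xy; rewrite -sX; exists y.
  rewrite -{1}sX => -[z Xz /funeqP zy]; suff <- : z = y by [].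
  by apply/funext => i; have := zy (i - 1); rewrite /shift_by subrK.
elim: n => [|n IH].
  by suff -> : shift_by 0 x = x by []; apply/funext => i; rewrite /shift_by addr0.
by rewrite intS -shift_byD sX1.
Qed.

Lemma shifted_cylinderE X (n : nat) w : subshift X ->
  shifted_cylinder X n%:Z w = X `&` [set x | word x (1 + n%:Z) (size w) = w].
Proof.
move=> sX; rewrite /shifted_cylinder /cylinder preimage_setI; congr (_ `&` _).
  by apply/seteqP; split=> x /(subshift_shift_by n x sX).
by apply/funext => x; rewrite /preimage /= word_shift_by.
Qed.

Lemma measurable_open (U : set (fullshift A)) : open U -> measurable U.
Proof. exact: sub_sigma_algebra. Qed.

Lemma measurable_subshift X : subshift X -> measurable X.
Proof.
move=> [cX _]; rewrite -(setCK X); apply: measurableC; apply: measurable_open.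
exact: closed_openC.
Qed.

(** A finite intersection of conditions on one coordinate, each open because projections to the
    discrete alphabet are continuous. *)
Lemma measurable_word (k : int) w :
  measurable [set x : fullshift A | word x k (size w) = w].
Proof.
have -> : [set x : fullshift A | word x k (size w) = w] =
    \bigcap_(i in `I_(size w)) [set x : fullshift A | x (k + i%:Z) = nth point w i].
  by apply/seteqP; split=> x /word_eqP.
apply: fin_bigcap_measurable => // i _; apply: measurable_open.
apply: (@open_comp (fullshift A) (discrete_topology A)
  (fun x => x (k + i%:Z)) [set nth point w i]); last exact: discrete_open.
move=> x _.
exact: (@proj_continuous int (fun=> discrete_topology A) (k + i%:Z)).
Qed.

Lemma measurable_shifted_cylinder X (n : nat) w :
  subshift X -> measurable (shifted_cylinder X n%:Z w).
Proof.
move=> sX; rewrite shifted_cylinderE//; apply: measurableI.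
  exact: measurable_subshift.
exact: measurable_word.
Qed.

Lemma measurable_cylinder X w : subshift X -> measurable (cylinder X w).
Proof.
move=> sX; apply: measurableI; [exact: measurable_subshift|exact: measurable_word].
Qed.

End subshift_theory.

(** * Consequences of mixing *)

Section mixing_theory.
Variables (R : realType) (A : pointedFinType).
Variables (X : set (fullshift A)) (mu : probability (fullshift A) R).
Hypothesis sX : subshift X.
Implicit Types (D : set (fullshift A)) (w : seq A).

Lemma local_bigcup_cylinder n D : D `<=` X ->
  (forall x y, X y -> word x 1 n = word y 1 n -> D x -> D y) ->
  D = \bigcup_(t in [set t : n.-tuple A | exists2 x, D x & word x 1 n = t])
        cylinder X t.
Proof.
move=> DX Dloc; apply/seteqP; split=> [x Dx|x [t [y Dy yt] [Xx /=]]].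
  have s : size (word x 1 n) == n by rewrite size_mkseq.
  exists (Tuple s) => /=; first by exists x.
  by split; [exact: DX|rewrite /= size_mkseq].
by rewrite size_tuple -yt => xy; apply: Dloc Dy.
Qed.

(** Within X, coordinates 1 to n decide membership in [D], which is thus a finite disjoint union of
    cylinders; additivity carries mixing over from these. *)
Lemma mixing_local n D w : mixing X mu -> language X w -> D `<=` X ->
  (forall x y, X y -> word x 1 n = word y 1 n -> D x -> D y) ->
  (fun k : nat => mu (shifted_cylinder X k%:Z w `&` D)) @ \oo
    --> (mu (cylinder X w) * mu D)%E.
Proof.
move=> mix Xw DX Dloc; have DE := local_bigcup_cylinder DX Dloc.
set T := [set t : n.-tuple A | _] in DE.
have muD B : measurable B ->
      mu (B `&` D) = (\sum_(t in T) mu (B `&` cylinder X t))%E.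
  move=> mB; rewrite DE setI_bigcupr measure_fin_bigcup//.
  - by rewrite [RHS]bigfs ?index_enum_uniq// ?set_mem_set// => t _;
      rewrite mem_index_enum.
  - exact: finite_finset.
  - move=> s t _ _ [x [[_ [_ +]] [_ [_ +]]]].
    by rewrite /= !size_tuple => -> /val_inj.
  - by move=> t _; apply: measurableI => //; exact: measurable_cylinder.
have -> : (fun k : nat => mu (shifted_cylinder X k%:Z w `&` D)) = fun k : nat =>
    (\sum_(t in T) mu (shifted_cylinder X k%:Z w `&` cylinder X t))%E.
  by apply/funext => k; rewrite muD//; exact: measurable_shifted_cylinder.
have -> : mu D = (\sum_(t in T) mu (cylinder X t))%E.
  rewrite -[D]setTI muD//; apply: eq_bigr => t _.
  by rewrite setTI.
rewrite ge0_sume_distrr//; apply: cvg_nnesum => t; first by move=> _; exact: nearW.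
rewrite inE => -[x Dx xt]; apply: mix => //.
by exists x; [exact: DX|exists 1; rewrite size_tuple].
Qed.

Definition hits w N : set (fullshift A) :=
  \bigcup_(i : 'I_N.+1) shifted_cylinder X (nat_of_ord i)%:Z w.

Lemma hitsP w N x : hits w N x <->
  X x /\ exists2 i, (i <= N)%N & word x (1 + i%:Z) (size w) = w.
Proof.
split=> [[i _]|[Xx [i iN xw]]].
  by rewrite shifted_cylinderE// => -[Xx xw]; split=> //; exists i => //; rewrite -ltnS.
exists (Ordinal (iN : (i < N.+1)%N)) => //.
by rewrite shifted_cylinderE.
Qed.

Lemma measurable_hits w N : measurable (hits w N).
Proof.
apply: fin_bigcup_measurable => // i _; exact: measurable_shifted_cylinder.
Qed.

Lemma subset_hits w M N : (M <= N)%N -> hits w M `<=` hits w N.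
Proof.
move=> MN x /hitsP[Xx [i iM xw]]; apply/hitsP; split=> //.
by exists i => //; exact: leq_trans MN.
Qed.

(** The occurrences of [w] that matter start at 1, ..., N + 1, so the last one ends at N + |w|. This
    locality lets [mixing_local] apply to the complement of [hits w N]. *)
Lemma miss_local w N x y : X y ->
  word x 1 (N + size w) = word y 1 (N + size w) ->
  (X `\` hits w N) x -> (X `\` hits w N) y.
Proof.
move=> Xy xy [Xx xN]; split=> // /hitsP[_ [i iN yw]]; apply: xN; apply/hitsP.
split=> //; exists i => //; rewrite -[RHS]yw; apply/eq_in_map => j.
rewrite mem_iota /= => jw.
have := congr1 (fun s => nth point s (i + j)%N) xy.
have ij : (i + j < N + size w)%N by rewrite -addnS leq_add.
by rewrite !nth_mkseq// PoszD addrA.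
Qed.

(* Put C_N = X \ hits w N and d = mu(cap_N C_N). Every sigma^(-k)[w] with k >= 0
   misses cap_N C_N, so mixing, applied to the finite union of cylinders C_N, gives
   mu[w] * mu(C_N) <= mu(C_N) - d; as N grows, mu[w] * d <= 0. *)
Lemma miss_cvg0 w : mu X = 1%E -> mixing X mu -> language X w ->
  (0 < mu (cylinder X w))%E ->
  (fun N => fine (mu (X `\` hits w N))) @ \oo --> (0 : R).
Proof.
move=> muX mix Xw w0.
have fm B : measurable B -> mu B \is a fin_num by exact: fin_num_measure.
pose D N := X `\` hits w N.
have mX := measurable_subshift sX.
have mD N : measurable (D N) by apply: measurableD => //; exact: measurable_hits.
have mw := measurable_cylinder w sX.
have mC : measurable (\bigcap_N D N) by exact: bigcap_measurable.
have DC : fine (mu (D N)) @[N --> \oo] --> fine (mu (\bigcap_N D N)).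
  apply: fine_cvg; rewrite fineK ?fm//; apply: nonincreasing_cvg_mu => //.
    by rewrite ltey_eq fm.
  by move=> M N MN; apply/subsetPset; apply: setDS; apply: subset_hits.
suff d0 : fine (mu (\bigcap_N D N)) = 0 by rewrite -d0.
have q0 : 0 < fine (mu (cylinder X w)).
  by apply: fine_gt0; rewrite w0 ltey_eq fm.
have step N : fine (mu (cylinder X w)) * fine (mu (D N)) <=
    fine (mu (D N)) - fine (mu (\bigcap_N D N)).
  have : (mu (cylinder X w) * mu (D N) <= mu (D N) - mu (\bigcap_N D N))%E.
    have cvgD := mixing_local mix Xw (@subDsetl _ X (hits w N)) (@miss_local w N).
    have mk (k : nat) : measurable (shifted_cylinder X k%:Z w `&` D N).
      by apply: measurableI => //; exact: measurable_shifted_cylinder.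
    rewrite -(cvg_lim _ cvgD)//; apply: lime_le; first exact: cvgP cvgD.
    apply: nearW => k; rewrite leeBrDr ?fm// -measureU//.
    - apply: le_measure; rewrite ?inE//.
        exact: measurableU.
      by move=> x [[]|/(_ N)]//; apply.
    (* Disjointness: a point of every [D N] lies in [D k], hence outside the last cylinder of
       [hits w k], which is sigma^(-k)[w]. *)
    - by apply/seteqP; split=> // x [[xk _] /(_ k I)[_]]; case; exists ord_max.
  rewrite -[mu (cylinder X w)]fineK ?fm//.
  by rewrite -[mu (D N)]fineK ?fm// -[mu (\bigcap_N D N)]fineK ?fm.
have : fine (mu (cylinder X w)) * fine (mu (\bigcap_N D N)) <=
    fine (mu (\bigcap_N D N)) - fine (mu (\bigcap_N D N)).
  have qDC : fine (mu (cylinder X w)) * fine (mu (D N)) @[N --> \oo] -->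
      fine (mu (cylinder X w)) * fine (mu (\bigcap_N D N)).
    by apply: cvgM; [exact: cvg_cst|exact: DC].
  have DC0 : fine (mu (D N)) - fine (mu (\bigcap_N D N)) @[N --> \oo] -->
      fine (mu (\bigcap_N D N)) - fine (mu (\bigcap_N D N)).
    by apply: cvgB; [exact: DC|exact: cvg_cst].
  by apply: (ler_cvg_to qDC DC0); exact: nearW.
rewrite subrr pmulr_rle0// => d0; apply/eqP; rewrite eq_le d0 /=.
by rewrite fine_ge0.
Qed.

(** Iterates one-step invariance. Measurability of the preimages is a hypothesis because it is
    immediate for the intersections of cylinders to which the lemma is applied. *)
Lemma mu_shift (B : set (fullshift A)) (n : nat) :
  invariant_probability X mu -> measurable B ->
  (forall m : nat, measurable (shift_by m%:Z @^-1` B)) ->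
  mu (shift_by n%:Z @^-1` B) = mu B.
Proof.
move=> [_ inv] mB mBn; elim: n => [|n <-].
  congr (mu _); apply/funext => x; congr (B _).
  by apply/funext => i; rewrite /shift_by addr0.
rewrite -[RHS]inv//; congr (mu _); apply/funext => x /=.
by rewrite shift_byD addrC -intS.
Qed.

Lemma shifted_cylinderD w (m n : nat) :
  shift_by n%:Z @^-1` (shifted_cylinder X m%:Z w) = shifted_cylinder X (m + n)%:Z w.
Proof.
by apply/funext => x; rewrite /shifted_cylinder /preimage /= shift_byD PoszD.
Qed.

(** The measure of sigma^(-k)[w] meeting [w] tends to mu[w]^2 > 0, hence is positive for k >= M.
    With k = j - i, invariance moves the pair by sigma^(-i). *)
Lemma mixing_overlap w : invariant_probability X mu -> mixing X mu ->
  language X w -> (0 < mu (cylinder X w))%E ->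
  exists M : nat, forall i j : nat, (i + M <= j)%N ->
    (0 < mu (shifted_cylinder X j%:Z w `&` shifted_cylinder X i%:Z w))%E.
Proof.
move=> inv mix Xw w0; have ww0 := mule_gt0 w0 w0.
have [M _ HM] := mix _ _ Xw Xw _ (open_ereal_gt' ww0).
exists M => i j ij.
have Mk : (M <= j - i)%N by lia.
have wE : cylinder X w = shifted_cylinder X 0%:Z w.
  by apply/seteqP; split=> x; rewrite shifted_cylinderE// addr0.
have := HM _ Mk; rewrite /= wE.
rewrite -(@mu_shift _ i inv).
- by rewrite preimage_setI !shifted_cylinderD add0n subnK//; lia.
- by apply: measurableI; exact: measurable_shifted_cylinder.
- move=> m; rewrite preimage_setI !shifted_cylinderD.
  by apply: measurableI; exact: measurable_shifted_cylinder.
Qed.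

Lemma hits_overlapping w : invariant_probability X mu -> mixing X mu ->
  language X w -> (0 < mu (cylinder X w))%E ->
  exists M : nat, forall N, (M <= N)%N -> finite_overlapping_union X mu (hits w N).
Proof.
move=> inv mix Xw w0; have [M HM] := mixing_overlap inv mix Xw w0.
exists (4 * M)%N => N MN.
exists N, (fun i => (nat_of_ord i)%:Z), (fun=> w); split=> // i j.
have far (a b : 'I_N.+1) : (a + M <= b)%N || (b + M <= a)%N ->
    (0 < mu (shifted_cylinder X (nat_of_ord a)%:Z w `&`
             shifted_cylinder X (nat_of_ord b)%:Z w))%E.
  by case/orP=> /HM//; rewrite setIC.
have [k [ik kj]] : exists k : 'I_N.+1,
    ((i + M <= k)%N || (k + M <= i)%N) /\ ((k + M <= j)%N || (j + M <= k)%N).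
  have [k kN [ik kj]] : exists2 k : nat, (k < N.+1)%N &
      ((i + M <= k)%N || (k + M <= i)%N) /\ ((k + M <= j)%N || (j + M <= k)%N).
    (* If i and j are both at least M, 0 is far from both; if both are below M, 2M is. If only one
       is below M, 4M works when the other is at most 3M, and 2M works otherwise. *)
    have [iM|iM] := leqP M i; have [jM|jM] := leqP M j.
    - by exists 0%N; lia.
    - by have [?|?] := leqP i (3 * M); [exists (4 * M)%N|exists (2 * M)%N]; lia.
    - by have [?|?] := leqP j (3 * M); [exists (4 * M)%N|exists (2 * M)%N]; lia.
    - by exists (2 * M)%N; lia.
  by exists (Ordinal kN).
by apply: (@connect_trans _ _ k); apply: connect1; apply: far.
Qed.

End mixing_theory.

Theorem theorem3p1 (R : realType) (A : pointedFinType)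
    (X Y : set (fullshift A)) (mu : probability (fullshift A) R)
    (subX : subshift X)
    (mme_mu : maximal_entropy_measure X mu)
    (mix_mu : mixing X mu)
    (pos_mu : positive_on_cylinders X mu)
    (subY : subshift Y) (YX : Y `<=` X)
    (hY_gt0 : 0 < top_entropy R Y)
    (hY_lt : top_entropy R Y < top_entropy R X)
    (eps : R) (eps_gt0 : 0 < eps) :
  exists G : set (fullshift A),
    [/\ finite_overlapping_union X mu G,
        ((1 - eps)%:E < mu G)%E,
        Y `<=` survivor X G &
        0 < top_entropy R (survivor X G)].
Proof.
have [inv _] := mme_mu.
have [w Xw Yw] : exists2 w, language X w & ~ language Y w.
  apply: contrapT => nw; move: hY_lt; rewrite ltNge top_entropy_le// => w Xw.
  by apply: contrapT => Yw; apply: nw; exists w.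
have w0 := pos_mu _ Xw.
have [M HM] := hits_overlapping subX inv mix_mu Xw w0.
have [K _ HK] := cvgr_lt _ (miss_cvg0 subX inv.1 mix_mu Xw w0) _ eps_gt0.
pose N := maxn M K; have YJ : Y `<=` survivor X (hits X w N).
  move=> y Yy; split=> [|n /(hitsP subX)[_ [i _ yw]]]; first exact: YX.
  (* An occurrence of [w] at 1 + i in sigma^n y is one at 1 + i + n in y, contrary to the choice of
     [w]. *)
  by apply: Yw; exists y => //; exists (1 + i%:Z + n); rewrite -word_shift_by.
exists (hits X w N); split=> //.
- by apply: HM; rewrite leq_maxl.
- have mX := measurable_subshift subX.
  have mG := measurable_hits subX w N.
  have GX : hits X w N `<=` X by move=> x /(hitsP subX)[].
  have muD : mu (X `\` hits X w N) = (mu X - mu (hits X w N))%E.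
    by rewrite measureD// ?ltey_eq ?fin_num_measure// (setIidr GX).
  (* [HK] makes the complement of G in X smaller than [eps], and mu X = 1 turns this into the lower
     bound on mu G. *)
  have := HK N (leq_maxr _ _); rewrite /= muD inv.1.
  rewrite -[mu (hits X w N)]fineK ?fin_num_measure// lte_fin -EFinB /=.
  by move: (fine _) => p; lra.
- by apply: lt_le_trans hY_gt0 _; apply/top_entropy_le/languageS.
Qed.
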